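(* Let $\mathbb{A}=\{a_1,\ldots,a_n\}$ be a list of integers with $1\le a_1\le\cdots\le a_n$. If $\mathcal{T}$ is an $\mathrm{lpp}_{\le}(\mathbb{A})$-vector, then so is $\mathcal{T}^*$. In particular, if $I\subset R=k[x_1,\ldots,x_n]$ is an $\mathrm{lpp}_{\le}(\mathbb{A})$-ideal, then so is $\langle x_1^{a_1},\ldots,x_n^{a_n}\rangle : I$.
   Context: $k$ is a field, $R=k[x_1,\ldots,x_n]$ is standard graded, monomials are ordered lexicographically with $x_1>\cdots>x_n$. Lex plus powers ideals: for a non-decreasing list of positive integers $\mathbb{B}=\{b_1,\ldots,b_n\}$, a monomial ideal $L\subset R$ is a $\mathbb{B}$-lex plus powers ideal ($LPP(\mathbb{B})$) if it is minimally generated by monomials $x_1^{b_1},\ldots,x_n^{b_n},m_1,\ldots,m_l$ such that for each $j$ all monomials of degree $\deg(m_j)$ that are larger than $m_j$ in lex order lie in $L$. An $\mathrm{lpp}_{\le}(\mathbb{A})$-ideal is a lex plus powers ideal (for some list $\mathbb{B}$) containing $x_1^{a_1},\ldots,x_n^{a_n}$; equivalently, an $LPP(\mathbb{B})$ ideal with $b_i\le a_i$ for all $i$. $\mathrm{lpp}_{\le}(\mathbb{A})$-vectors: write $\mathbb{A}_2=\{a_2,\ldots,a_n\}$. The vectors, their length $l$, the parameters $\sigma$ and $\alpha_{\mathbb{A}}$, and the special vector $\mathcal{T}_{c.i.(\mathbb{A})}$ are defined recursively on $n$. If $n=1$, an $\mathrm{lpp}_{\le}(\mathbb{A})$-vector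 is $\mathcal{T}=(d)$ with $d$ an integer, $1\le d\le a_1$; $\mathcal{T}_{c.i.(\mathbb{A})}=(a_1)$; $l(\mathcal{T})=\sigma(\mathcal{T})=d$; and $\alpha_{\mathbb{A}}(\mathcal{T})=d$ if $d<a_1$, $\alpha_{\mathbb{A}}(\mathcal{T})=\infty$ if $d=a_1$. If $n>1$, $\mathcal{T}=(\mathcal{T}_1,\ldots,\mathcal{T}_u)$ with $u\ge 1$ is an $\mathrm{lpp}_{\le}(\mathbb{A})$-vector if $u\le a_1$, $u\le l(\mathcal{T}_u)$, each $\mathcal{T}_i$ is an $\mathrm{lpp}_{\le}(\mathbb{A}_2)$-vector, and $\sigma(\mathcal{T}_i)<\alpha_{\mathbb{A}_2}(\mathcal{T}_{i+1})$ for $1\le i\le u-1$. Put $l(\mathcal{T})=u$. Put $\sigma(\mathcal{T})=\sigma(\mathcal{T}_u)$ if $\mathcal{T}_u\ne\mathcal{T}_{c.i.(\mathbb{A}_2)}$, and $\sigma(\mathcal{T})=\sigma(\mathcal{T}_u)+s-1$ if $\mathcal{T}_u=\mathcal{T}_{c.i.(\mathbb{A}_2)}$, where $s=\#\{i:\mathcal{T}_i=\mathcal{T}_u\}$. Put $\alpha_{\mathbb{A}}(\mathcal{T})=l(\mathcal{T})$ if $l(\mathcal{T})<a_1$, and $\alpha_{\mathbb{A}}(\mathcal{T})=l(\mathcal{T})+\alpha_{\mathbb{A}_2}(\mathcal{T}_1)-1$ if $l(\mathcal{T})=a_1$. Finally $\mathcal{T}=\mathcal{T}_{c.i.(\mathbb{A})}$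 if $l(\mathcal{T})=a_1$ and every $\mathcal{T}_i=\mathcal{T}_{c.i.(\mathbb{A}_2)}$. Dual vector $\mathcal{T}^*$ (relative to $\mathbb{A}$), defined recursively: if $n=1$ and $\mathcal{T}=(d)$, then $\mathcal{T}^*=(a_1-d)$ if $d<a_1$ and $\mathcal{T}^*=\emptyset$ if $d=a_1$. If $n>1$ and $\mathcal{T}=(\mathcal{T}_1,\ldots,\mathcal{T}_u)$, then $$\mathcal{T}^*=((\mathcal{T}_u)^*,\ldots,(\mathcal{T}_1)^*,\mathcal{T}_{c.i.(\mathbb{A}_2)},\ldots,\mathcal{T}_{c.i.(\mathbb{A}_2)})$$ with $a_1-u$ (possibly $0$) copies of $\mathcal{T}_{c.i.(\mathbb{A}_2)}$ at the end, where the duals $(\mathcal{T}_i)^*$ are taken relative to $\mathbb{A}_2$ and empty entries $(\mathcal{T}_i)^*=\emptyset$ are omitted (so $\mathcal{T}^*=\emptyset$ exactly when $\mathcal{T}=\mathcal{T}_{c.i.(\mathbb{A})}$). Convention: the empty vector $\emptyset$ is regarded as a (degenerate) $\mathrm{lpp}_{\le}(\mathbb{A})$-vector and the unit ideal $R$ as a (degenerate) $\mathrm{lpp}_{\le}(\mathbb{A})$-ideal; these arise as dual/residual only from $\mathcal{T}_{c.i.(\mathbb{A})}$ and $\langle x_1^{a_1},\ldots,x_n^{a_n}\rangle$ respectively.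
   Formalization: In an lpp_≤(A)-ideal, each generator x_i^{b_i} with b_i < a_i must also satisfy the lex condition, in hypothesis and conclusion; without this the ideal claim fails, e.g. A=(3,3), I=<x^2,y^2> has residual <x^3,xy,y^3>, which is not lex plus powers. *)

(* Defs.v *)
From mathcomp Require Import all_boot all_order all_algebra.
From mathcomp.multinomials Require Export mpoly.

Set Implicit Arguments.
Unset Strict Implicit.
Unset Printing Implicit Defensive.

Import GRing.Theory.
Local Open Scope ring_scope.

(* The number of variables is n.+1, so that a list a_1, ..., a_(n.+1) is a
   A : n.+1.-tuple nat and the variable x_(i+1) is 'X_i with i : 'I_n.+1.     *)

(** ** Vectors *)

Section Vectors.
Local Open Scope nat_scope.

(* [tvec n] hosts the vectors attached to lists of length n.+1: (d) is
   [:: d] : tvec 0, and the degenerate vector is the empty sequence at every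
   level.                                                                     *)
Fixpoint tvec (n : nat) : eqType :=
  if n is m.+1 then seq (tvec m) : eqType else seq nat : eqType.

Definition tempty (n : nat) : tvec n :=
  match n return tvec n with 0 => [::] | _.+1 => [::] end.

(* In the recursive definitions below the values on vectors that do not satisfy
   [lpp_le_vector] are irrelevant, except that [tdual] maps the empty vector to
   [tci A], in accordance with J : R = J.                                     *)

Fixpoint tci n : n.+1.-tuple nat -> tvec n :=
  match n return n.+1.-tuple nat -> tvec n with
  | 0 => fun A => [:: thead A]
  | m.+1 => fun A => nseq (thead A) (@tci m (behead_tuple A))
  end.

Definition tlen n : tvec n -> nat :=
  match n return tvec n -> nat with
  | 0 => fun T => head 0 T
  | _.+1 => fun T => size T
  end.

Fixpoint sigma n : n.+1.-tuple nat -> tvec n -> nat :=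
  match n return n.+1.-tuple nat -> tvec n -> nat with
  | 0 => fun _ T => head 0 T
  | m.+1 => fun A T =>
      let A2 := behead_tuple A in
      let Tu := last (tempty m) T in
      if Tu != tci A2 then @sigma m A2 Tu
      else @sigma m A2 Tu + count_mem Tu T - 1
  end.

(* [None] stands for infinity. *)
Fixpoint alpha n : n.+1.-tuple nat -> tvec n -> option nat :=
  match n return n.+1.-tuple nat -> tvec n -> option nat with
  | 0 => fun A T => if head 0 T < thead A then Some (head 0 T) else None
  | m.+1 => fun A T =>
      if size T < thead A then Some (size T)
      else omap (fun c => size T + c - 1)
                (@alpha m (behead_tuple A) (head (tempty m) T))
  end.

Definition ltn_infty (s : nat) (c : option nat) : bool :=
  if c is Some c' then s < c' else true.

Fixpoint lpp_le_vector n : n.+1.-tuple nat -> tvec n -> bool :=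
  match n return n.+1.-tuple nat -> tvec n -> bool with
  | 0 => fun A T => (size T == 1) && (1 <= head 0 T <= thead A)
  | m.+1 => fun A T =>
      let A2 := behead_tuple A in
      [&& 1 <= size T <= thead A,
          size T <= tlen (last (tempty m) T),
          all (@lpp_le_vector m A2) T
        & sorted (fun S S' => ltn_infty (sigma A2 S) (alpha A2 S')) T]
  end.

Fixpoint tdual n : n.+1.-tuple nat -> tvec n -> tvec n :=
  match n return n.+1.-tuple nat -> tvec n -> tvec n with
  | 0 => fun A T => if head 0 T < thead A then [:: thead A - head 0 T] else [::]
  | m.+1 => fun A T =>
      let A2 := behead_tuple A in
      [seq S <- rev (map (@tdual m A2) T) | S != tempty m]
        ++ nseq (thead A - size T) (tci A2)
  end.

End Vectors.

(** ** Ideals *)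

Section Ideals.
Variables (k : fieldType) (n : nat).
Local Notation R := {mpoly k[n.+1]}.
Implicit Types (I J : R -> Prop) (gs ms : seq 'X_{1..n.+1}).

Definition same_ideal I J : Prop := forall f, I f <-> J f.

Definition unit_ideal : R -> Prop := fun _ => True.

Definition monomial_span gs : R -> Prop := fun f =>
  exists c : 'I_(size gs) -> R, f = \sum_(i < size gs) c i * 'X_[nth 0%MM gs i].

Definition minimally_generated I gs : Prop :=
  same_ideal I (monomial_span gs) /\
  forall gs', subseq gs' gs -> same_ideal I (monomial_span gs') -> gs' = gs.

Definition colon J I : R -> Prop := fun f => forall g, I g -> J (f * g).

Definition pure_power (A : n.+1.-tuple nat) (i : 'I_n.+1) : 'X_{1..n.+1} :=
  (U_(i) *+ tnth A i)%MM.

Definition pure_powers (A : n.+1.-tuple nat) : seq 'X_{1..n.+1} :=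
  [seq pure_power A i | i <- enum 'I_n.+1].

Definition lex_gt (m m' : 'X_{1..n.+1}) : Prop :=
  exists i : 'I_n.+1,
    (forall j : 'I_n.+1, (j < i)%N -> m j = m' j) /\ (m' i < m i)%N.

Definition lex_closed_at I (m : 'X_{1..n.+1}) : Prop :=
  forall m', mdeg m' = mdeg m -> lex_gt m' m -> I 'X_[m'].

Definition lex_plus_powers (B : n.+1.-tuple nat) I : Prop :=
  [/\ sorted leq B, all (leq 1) B &
      exists ms, minimally_generated I (pure_powers B ++ ms) /\
                 forall m, m \in ms -> lex_closed_at I m].

(* Relative to A, the only minimal generators exempted from the lex condition
   are the powers prescribed by A: a generator x_i^{b_i} with b_i < a_i counts
   as one of the other generators, whence the last clause.  Without it,
   <x^2, y^2> would qualify for A = (3, 3), although its residual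
   <x^3, y^3> : <x^2, y^2> = <x^3, x y, y^3> is not a lex plus powers ideal,
   and ideals would not correspond to vectors.                                *)
Definition lpp_le_ideal (A : n.+1.-tuple nat) I : Prop :=
  exists B, [/\ lex_plus_powers B I,
                forall i : 'I_n.+1, I ('X_i ^+ tnth A i) &
                forall i : 'I_n.+1, (tnth B i < tnth A i)%N ->
                  lex_closed_at I (pure_power B i)].

End Ideals.

Arguments unit_ideal {k n} f.
Arguments monomial_span k {n} gs f.

(* Main.v *)
Require Import Defs.
From mathcomp Require Import all_boot all_order all_algebra.
From mathcomp.multinomials Require Import mpoly.
From mathcomp Require Import zify.

(** Both halves rest on the duality that sends a monomial m dividing the top
    monomial M = x_1^(a_1 - 1) ... x_n^(a_n - 1) to M / m, where
    J = (x_1^a_1, ..., x_n^a_n).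

    Ideals. An ideal is an lpp ideal relative to A exactly when it is a proper
    monomial ideal I containing J in which every monomial outside J is
    lex-closed: all lex-larger monomials of its degree lie in I
    ([lpp_le_ideal_lex], [lex_lpp_le_ideal]). Passing from generators to all
    monomials works because the lex-closed monomials of I are stable under
    multiplication by variables ([lex_closed_mul_var]); the way back takes the
    minimal monomial generators, and the lex condition itself forces the
    exponents of the pure powers among them to be non-decreasing. A monomial m
    dividing M lies in J : I if and only if M / m is not in I ([colon_top]).
    Since m -> M / m reverses the lex order in each degree, an m' lex-larger
    than m in J : I but outside J : I would put M / m' in I, hence the
    lex-larger M / m as well, a contradiction ([colon_lpp]).

    Vectors. For the ideal I attached to T, alpha(T) is the least degree of a
    monomial of I outside J and sigma(T) is the least degree in which I is
    everything. With e = sigma(T_ci) = deg M + 1, the duality suggests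
    alpha(T^* ) = e - sigma(T) and sigma(T^* ) = e - alpha(T), and these two
    formulas are proved together with the claim by induction on the number of
    variables ([tdual_exchange]): they turn the condition
    sigma(T_i) < alpha(T_(i+1)) into the same condition for the reversed list
    of duals. The induction needs 1 <= alpha(T) <= sigma(T) < e for every lpp
    vector T other than T_ci ([lpp_alpha_sigma]); this also shows that the
    entries equal to T_ci form a tail ([lpp_split]). *)

Set Implicit Arguments.
Unset Strict Implicit.
Unset Printing Implicit Defensive.
Import GRing.Theory.

(** * The numbers alpha and sigma of a vector *)

Section Seq.
Variable T : eqType.

(** Once a sorted list reaches an element that relates only to itself, it stays
    there. This is what splits a vector into its proper entries followed by
    copies of the complete intersection. *)
Lemma absorbing_tail (P : pred T) (e : rel T) (c : T) s :
  (forall y, P y -> e c y -> y = c) -> all P s -> sorted e s ->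
  s = [seq x <- s | x != c] ++ nseq (count_mem c s) c.
Proof.
move=> c_abs; elim: s => //= x s IHs /andP[Px Ps] e_xs.
have [x_c | _] := eqVneq x c => /=; last first.
  by rewrite -(IHs Ps (path_sorted e_xs)).
suff /all_pred1P s_c : all (pred1 c) s.
  suff [k ->] : exists k, s = nseq k c.
    by rewrite filter_nseq count_nseq /= !eqxx /= mul1n x_c.
  by exists (size s).
subst x; elim: s {IHs} Ps e_xs => //= y s IHs /andP[Py Ps] /andP[e_cy e_ys].
have y_c := c_abs y Py e_cy; subst y; rewrite eqxx; exact: IHs.
Qed.

Lemma sorted_cat_nseq (e : rel T) c s t :
  (forall x, e x c) -> sorted e s -> sorted e (s ++ nseq t c).
Proof.
move=> e_c; have e_nseq y : path e y (nseq t c).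
  by elim: t y => //= t IHt y; rewrite e_c IHt.
case: s => [_|x s /= e_s]; last by rewrite cat_path e_s e_nseq.
by case: t e_nseq => //= t /(_ c)/andP[].
Qed.

End Seq.

Definition nondec_pos n (A : n.+1.-tuple nat) := all (leq 1) A && sorted leq A.

Lemma nondec_pos_thead n (A : n.+1.-tuple nat) : nondec_pos A -> 0 < thead A.
Proof. by case/tupleP: A => a A /andP[/= /andP[]]; rewrite theadE. Qed.

Lemma nondec_pos_behead n (A : n.+2.-tuple nat) : nondec_pos A ->
  nondec_pos (behead_tuple A) /\ thead A <= thead (behead_tuple A).
Proof.
case/tupleP: A => a A; case/tupleP: A => b A.
rewrite /nondec_pos !theadE /=.
by case/andP=> /and3P[_ -> ->] /andP[le_ab ->]; split.
Qed.

Lemma tlen_tci n (A : n.+1.-tuple nat) : tlen (tci A) = thead A.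
Proof. by case: n A => // n A; rewrite /= size_nseq. Qed.

Lemma alpha_tci n (A : n.+1.-tuple nat) :
  nondec_pos A -> alpha A (tci A) = None.
Proof.
elim: n A => [|n IHn] A A_ok /=; first by rewrite ltnn.
rewrite size_nseq ltnn; have := nondec_pos_thead A_ok.
case: (thead A) => //= a _.
by rewrite IHn //; case: (nondec_pos_behead A_ok).
Qed.

Lemma tdual_tci n (A : n.+1.-tuple nat) :
  nondec_pos A -> tdual A (tci A) = tempty n.
Proof.
elim: n A => [|n IHn] A A_ok /=; first by rewrite ltnn.
have [A2_ok _] := nondec_pos_behead A_ok.
rewrite size_nseq subnn cats0 map_nseq IHn //.
by rewrite filter_rev filter_nseq eqxx.
Qed.

Lemma last_nseqS (T : Type) (x y : T) s : last x (nseq s.+1 y) = y.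
Proof. by elim: s x => //= s IHs x; apply: IHs. Qed.

(** Each trailing copy of the complete intersection beyond the first raises
    sigma by one; the hypothesis on [P] makes [s.+1] the multiplicity that the
    definition of [sigma] counts. *)
Lemma sigma_tail n (A : n.+2.-tuple nat) (c := tci (behead_tuple A))
    (P : seq (tvec n)) s : c \notin P ->
  @sigma n.+1 A (P ++ nseq s.+1 c) = sigma (behead_tuple A) c + s.
Proof.
move=> cNP; rewrite /= last_cat last_nseqS eqxx /=.
rewrite count_cat (count_memPn cNP) -[c :: nseq s c]/(nseq s.+1 c) count_nseq.
by rewrite inE eqxx mul1n add0n addnS subn1.
Qed.

Lemma sigma_rcons n (A : n.+2.-tuple nat) (P : seq (tvec n)) y :
  y != tci (behead_tuple A) ->
  @sigma n.+1 A (rcons P y) = sigma (behead_tuple A) y.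
Proof. by move=> yNc; rewrite /= last_rcons yNc. Qed.

Lemma alpha_cat_nseq n (A : n.+2.-tuple nat) (P : seq (tvec n)) s c :
  @alpha n.+1 A (P ++ nseq s c) =
  if size P + s < thead A then Some (size P + s)
  else omap (fun b => size P + s + b - 1)
         (alpha (behead_tuple A) (head (tempty n) (P ++ nseq s c))).
Proof. by rewrite /= size_cat size_nseq. Qed.

Lemma sigma_tci n (A : n.+2.-tuple nat) : nondec_pos A ->
  sigma A (tci A) =
  sigma (behead_tuple A) (tci (behead_tuple A)) + (thead A).-1.
Proof.
move=> A_ok; rewrite -(sigma_tail (P := [::])) // prednK //.
exact: nondec_pos_thead.
Qed.

Lemma sigma_tci_gt0 n (A : n.+1.-tuple nat) :
  nondec_pos A -> 0 < sigma A (tci A).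
Proof.
elim: n A => [|n IHn] A A_ok; first exact: nondec_pos_thead.
by rewrite sigma_tci // addn_gt0 IHn //; case: (nondec_pos_behead A_ok).
Qed.

Lemma lpp_tci n (A : n.+1.-tuple nat) : nondec_pos A -> lpp_le_vector A (tci A).
Proof.
elim: n A => [|n IHn] A A_ok /=.
  by rewrite leqnn andbT; exact: nondec_pos_thead.
have [A2_ok le_A] := nondec_pos_behead A_ok.
have A_gt0 := nondec_pos_thead A_ok.
rewrite size_nseq leqnn A_gt0 /=.
have -> : last (tempty n) (nseq (thead A) (tci (behead_tuple A)))
    = tci (behead_tuple A) by rewrite -(prednK A_gt0) last_nseqS.
rewrite tlen_tci le_A all_nseq IHn // orbT /=.
apply: (@sorted_cat_nseq _ _ _ [::]) => // x; by rewrite alpha_tci.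
Qed.

Lemma lpp_neq_empty n (A : n.+1.-tuple nat) (T : tvec n) :
  lpp_le_vector A T -> T != tempty n.
Proof. by case: n A T => [|n] A [|]. Qed.

(** In terms of ideals: if x_1^b with b < a_1 lies in I then b bounds the
    initial degree of I modulo J. It reduces the condition on the length of the last
    entry of a vector to a bound on the alpha of that entry. *)
Lemma alpha_le_tlen n (A : n.+1.-tuple nat) (T : tvec n) a :
  alpha A T = Some a -> a <= tlen T \/ thead A <= tlen T.
Proof.
case: n A T => [|n] A T /=; case: ifP; rewrite ?ltnNge.
- by move=> _ [->]; left.
- by [].
- by move=> _ [->]; left.
by move=> /negbFE; right.
Qed.

(** The right-most bound says that the ideal contains the socle of R / J, whose
    degree is [(sigma A (tci A)).-1]. *)
Definition alpha_sigma_bounds n (A : n.+1.-tuple nat) (T : tvec n) :=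
  exists2 a, alpha A T = Some a
    & [&& 0 < a, a <= sigma A T & sigma A T < sigma A (tci A)].

Lemma lpp_vectorS n (A : n.+2.-tuple nat) (A2 := behead_tuple A)
    (T : seq (tvec n)) :
  @lpp_le_vector n.+1 A T =
  [&& 0 < size T <= thead A, size T <= tlen (last (tempty n) T),
      all (lpp_le_vector A2) T
    & sorted (fun S S' => ltn_infty (sigma A2 S) (alpha A2 S')) T].
Proof. by []. Qed.

(** An entry following a complete intersection has alpha larger than the largest
    possible sigma, so its alpha is infinite and it is a complete intersection
    too. The bounds on the entries are a hypothesis because the lemma serves in
    the induction that proves them. *)
Lemma lpp_split n (A : n.+2.-tuple nat) (A2 := behead_tuple A)
    (T : seq (tvec n)) :
  nondec_pos A ->
  (forall S : tvec n,
     lpp_le_vector A2 S -> S != tci A2 -> alpha_sigma_bounds A2 S) ->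
  @lpp_le_vector n.+1 A T -> T != tci A :> tvec n.+1 ->
  exists P : seq (tvec n), exists s : nat,
  [/\ T = P ++ nseq s (tci A2), tci A2 \notin P, all (lpp_le_vector A2) P
    & sorted (fun S S' => ltn_infty (sigma A2 S) (alpha A2 S')) P] /\
  0 < size P + s <= thead A /\ s < thead A.
Proof.
rewrite lpp_vectorS.
move=> A_ok bounds /and4P[/andP[T_gt0 T_le] _ T_lpp T_sorted] TNci.
set c := tci A2; set e := (fun S S' => _) in T_sorted *.
have T_eq : T = [seq S <- T | S != c] ++ nseq (count_mem c T) c.
  apply: (@absorbing_tail _ (lpp_le_vector A2) e) => // S S_lpp; rewrite /e.
  have [// | SNc] := eqVneq S c.
  have [a -> /and3P[_ le_a lt_c] lt_a] := bounds S S_lpp SNc.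
  by have := leq_trans (ltn_trans lt_c lt_a) le_a; rewrite ltnn.
exists [seq S <- T | S != c], (count_mem c T); split; first split=> //.
- by rewrite mem_filter eqxx.
- by rewrite all_filter; apply: sub_all T_lpp => S S_lpp; apply/implyP.
- move: T_sorted; rewrite {1}T_eq; case: [seq S <- T | S != c] => //= S P.
  by rewrite cat_path => /andP[].
have size_T : size [seq S <- T | S != c] + count_mem c T = size T.
  by rewrite {3}T_eq size_cat size_nseq.
rewrite size_T T_gt0 T_le; split=> //.
rewrite ltnNge; apply: contra TNci => ge_c; rewrite T_eq.
have P_nil : [seq S <- T | S != c] = [::] by apply: size0nil; lia.
have -> : count_mem c T = thead A by lia.
by rewrite P_nil.
Qed.

(** Consecutive entries satisfy sigma(S) < alpha(S') <= sigma(S'). *)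
Lemma sigma_growth n (A : n.+1.-tuple nat) S (P : seq (tvec n)) :
  {in S :: P, forall S', alpha_sigma_bounds A S'} ->
  path (fun S S' => ltn_infty (sigma A S) (alpha A S')) S P ->
  sigma A S + size P <= sigma A (last S P).
Proof.
elim: P S => [|S' P IHP] S bounds /=; first by rewrite addn0.
move=> /andP[lt_SS' S'P].
have [|a aE a_le] := bounds S'; first by rewrite !inE eqxx orbT.
rewrite aE /= in lt_SS'.
have : sigma A S' + size P <= sigma A (last S' P).
  by apply: IHP => // U PU; apply: bounds; rewrite inE PU orbT.
by lia.
Qed.

(** Sigma grows strictly along the [r] entries other than the complete
    intersection, so alpha(T_1) + r - 1 <= sigma(T_r) < e_2, where e_2 is the
    sigma of the complete intersection. The [s] trailing complete intersections
    raise alpha(T) by [s], and for [s > 0] they make sigma(T) = e_2 - 1 + s. *)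
Lemma lpp_alpha_sigma n (A : n.+1.-tuple nat) (T : tvec n) :
  nondec_pos A -> lpp_le_vector A T -> T != tci A -> alpha_sigma_bounds A T.
Proof.
elim: n A T => [|n IHn] A T A_ok.
  case: T => [|d [|//]] //= d_le; rewrite /alpha_sigma_bounds /= => dNa.
  have lt_d : d < thead A by move: dNa; rewrite eqseq_cons andbT; lia.
  by exists d; rewrite ?lt_d //; lia.
have [A2_ok _] := nondec_pos_behead A_ok.
have bounds S := IHn _ S A2_ok.
move=> T_lpp TNci.
have [P [s [[-> cNP P_lpp P_sorted] [size_T s_lt]]]] :=
  lpp_split A_ok bounds T_lpp TNci.
have P_bounds : {in P, forall S, alpha_sigma_bounds (behead_tuple A) S}.
  move=> S PS; apply: bounds; first exact: (allP P_lpp).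
  by apply: contraNneq cNP => <-.
have ci_gt0 := sigma_tci_gt0 A2_ok; have sigma_A := sigma_tci A_ok.
rewrite /alpha_sigma_bounds sigma_A alpha_cat_nseq.
case: s s_lt size_T {T_lpp TNci} => [|s] s_lt size_T; last first.
  rewrite sigma_tail //.
  case: P cNP {P_lpp} P_sorted P_bounds size_T =>
      [|S P] cNP P_sorted P_bounds size_T.
    by rewrite /= s_lt; exists s.+1 => //; lia.
  have [a aE a_le] := P_bounds S (mem_head _ _).
  have := sigma_growth P_bounds P_sorted.
  have [b _ b_le] := P_bounds _ (mem_last S P).
  case: ifP => size_lt growth.
    by exists (size (S :: P) + s.+1) => //=; lia.
  (* Here T has a_1 entries, so alpha(T) = a_1 + alpha(T_1) - 1. *)
  by rewrite /= aE /=; eexists; [by []|]; rewrite /= in size_T size_lt; lia.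
case: P cNP {P_lpp} P_sorted P_bounds size_T =>
    [|S P] cNP P_sorted P_bounds size_T //.
have [a aE a_le] := P_bounds S (mem_head _ _).
have := sigma_growth P_bounds P_sorted.
have [b _ b_le] := P_bounds _ (mem_last S P).
rewrite cats0 lastI sigma_rcons; last first.
  by apply: contraNneq cNP => <-; apply: mem_last.
rewrite -lastI.
case: ifP => size_lt growth; first by exists (size (S :: P) + 0) => //=; lia.
by rewrite /= aE /=; eexists; [by []|]; rewrite /= in size_T size_lt; lia.
Qed.

(** * Duality of vectors *)

(** The two formulas express that [m -> M / m] exchanges the lowest degree of I
    modulo J with the highest degree not contained in J : I, and conversely.
    They are bundled with the lpp condition since each step of the induction
    uses all three for the entries. *)
Definition dual_exchange n (A : n.+1.-tuple nat) (T : tvec n) :=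
  [/\ lpp_le_vector A (tdual A T),
      alpha A (tdual A T) = Some (sigma A (tci A) - sigma A T) &
      forall a, alpha A T = Some a ->
        sigma A (tdual A T) = sigma A (tci A) - a].

Lemma tdual_split n (A : n.+2.-tuple nat) (A2 := behead_tuple A)
    (P : seq (tvec n)) s : nondec_pos A2 ->
  {in P, forall S, tdual A2 S != tempty n} ->
  @tdual n.+1 A (P ++ nseq s (tci A2)) =
  rev (map (tdual A2) P) ++ nseq (thead A - (size P + s)) (tci A2).
Proof.
move=> A2_ok P_dual; rewrite /= size_cat size_nseq -/A2; congr (_ ++ _).
rewrite filter_rev map_cat map_nseq filter_cat tdual_tci //.
rewrite filter_nseq eqxx cats0.
congr rev; apply/all_filterP/allP => _ /mapP[S PS ->]; exact: P_dual.
Qed.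

(** Let [T] have [size P] proper entries, [s] trailing complete intersections
    and [t = a_1 - u]. The dual swaps the roles of [s] and [t]: the case [s = 0]
    computes alpha(T^* ) from the last entry of [T], the case [t = 0] computes
    sigma(T^* ) from the first. *)
Lemma tdual_exchange n (A : n.+1.-tuple nat) (T : tvec n) :
  nondec_pos A -> lpp_le_vector A T -> T != tci A -> dual_exchange A T.
Proof.
elim: n A T => [|n IHn] A T A_ok.
  case: T => [|d [|//]] //= d_le; rewrite eqseq_cons andbT => dNa.
  have lt_d : d < thead A by lia.
  have lt_d' : thead A - d < thead A by lia.
  rewrite /dual_exchange /= !lt_d /= lt_d'; split=> // [|a [<-] //].
  by rewrite /=; lia.
have [A2_ok A_le] := nondec_pos_behead A_ok.
set A2 := behead_tuple A in A2_ok A_le; set c := tci A2.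
have A_gt0 := nondec_pos_thead A_ok.
move=> T_lpp TNci.
have bounds S : lpp_le_vector A2 S -> S != c -> alpha_sigma_bounds A2 S.
  exact: lpp_alpha_sigma.
have [P [s [[T_eq cNP P_lpp P_sorted] [size_T s_lt]]]] :=
  lpp_split A_ok bounds T_lpp TNci.
have PNc : {in P, forall S, S != c}.
  by move=> S PS; apply: contraNneq cNP => S_c; rewrite S_c in PS.
have P_bounds : {in P, forall S, alpha_sigma_bounds A2 S}.
  by move=> S PS; apply: bounds; [apply: (allP P_lpp) | apply: PNc].
have P_dual : {in P, forall S, dual_exchange A2 S}.
  by move=> S PS; apply: IHn => //; [apply: (allP P_lpp) | apply: PNc].
have dualNc : {in P, forall S, tdual A2 S != c}.
  move=> S PS; have [_ aE _] := P_dual S PS; apply/eqP => dual_c.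
  by rewrite dual_c alpha_tci in aE.
have dual_eq : tdual A T =
    rev (map (tdual A2) P) ++ nseq (thead A - (size P + s)) c.
  rewrite T_eq tdual_split // => S PS.
  by have [dual_lpp _ _] := P_dual S PS; apply: lpp_neq_empty dual_lpp.
pose t := thead A - (size P + s); rewrite -/t in dual_eq.
pose D := rev (map (tdual A2) P); rewrite -/D in dual_eq.
have size_D : size D = size P by rewrite size_rev size_map.
have cND : c \notin D.
  by rewrite mem_rev; apply/mapP => -[S /dualNc/eqP SNc c_S]; apply: SNc.
have ci_gt0 := sigma_tci_gt0 A2_ok; have sigma_A := sigma_tci A_ok.
rewrite -/A2 -/c in sigma_A.
have head_D x Q : P = rcons Q x -> D = tdual A2 x :: rev (map (tdual A2) Q).
  by rewrite /D => ->; rewrite map_rcons rev_rcons.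
have last_D x Q : P = x :: Q -> D = rcons (rev (map (tdual A2) Q)) (tdual A2 x).
  by rewrite /D => ->; rewrite /= rev_cons.
split.
- rewrite dual_eq lpp_vectorS -/A2; apply/and4P; split.
  + rewrite size_cat size_nseq size_D /t; lia.
  + rewrite size_cat size_nseq size_D; case tE : t => [|t'].
      case PE : P size_T P_bounds P_sorted P_dual =>
          [|x Q] size_T P_bounds P_sorted P_dual.
        by rewrite /t PE /= in tE; lia.
      rewrite (last_D _ _ PE) cats0 last_rcons addn0.
      (* The last entry of the dual is the dual of T_1, and its alpha, which is
         e_2 - sigma(T_1), is at least the number of proper entries because
         sigma grows strictly along them up to at most e_2 - 1. *)
      have [b _ b_le] := P_bounds _ (mem_last x Q).
      have growth := sigma_growth P_bounds P_sorted.
      have [_ /alpha_le_tlen tlen_dual _] := P_dual x (mem_head _ _).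
      by rewrite -/c /= in size_T growth b_le tlen_dual *; lia.
    by rewrite last_cat last_nseqS tlen_tci; lia.
  + rewrite all_cat all_nseq lpp_tci // orbT andbT all_rev all_map.
    by apply/allP => S PS; have [] := P_dual S PS.
  apply: sorted_cat_nseq => [S|]; first by rewrite alpha_tci.
  rewrite rev_sorted sorted_map.
  apply: (sub_in_sorted (P := mem P) _ _ P_sorted); last exact/allP.
  move=> S S' PS PS' /=; have [a' aE' a_le'] := P_bounds S' PS'; rewrite aE' /=.
  have [_ -> _] := P_dual S PS; have [_ _ /(_ _ aE') ->] := P_dual S' PS'.
  have [a aE a_le] := P_bounds S PS.
  by rewrite /= -/A2 -/c in a_le a_le' *; lia.
- rewrite dual_eq alpha_cat_nseq size_D T_eq sigma_A; case sE : s => [|s'].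
    have -> : (size P + t < thead A) = false by rewrite /t; lia.
    case/lastP PE : P size_T P_bounds P_dual PNc =>
        [|Q x] size_T P_bounds P_dual PNc; first by rewrite sE in size_T.
    have xP : x \in rcons Q x by rewrite mem_rcons mem_head.
    rewrite (head_D _ _ PE) (cats0 (rcons Q x)) sigma_rcons ?PNc // -/A2 /=.
    have [_ -> _] := P_dual x xP; have [a _ a_le] := P_bounds x xP.
    by rewrite /= -/c in a_le *; congr Some; rewrite /t PE; lia.
  rewrite sigma_tail // -/A2 -/c.
  have -> : size P + t < thead A by rewrite /t; lia.
  by congr Some; rewrite /t; lia.
move=> a; rewrite {1}T_eq alpha_cat_nseq -/A2.
rewrite dual_eq sigma_A; case tE : t => [|t']; rewrite /t in tE.
  have -> : (size P + s < thead A) = false by lia.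
  case PE : P size_T P_bounds P_dual => [|x Q] size_T P_bounds P_dual.
    by rewrite PE /= in tE; lia.
  rewrite (last_D _ _ PE) cats0 sigma_rcons ?dualNc ?PE ?mem_head //.
  have [_ _ sE] := P_dual x (mem_head _ _).
  have [b bE b_le] := P_bounds x (mem_head _ _).
  rewrite /= bE /= (sE _ bE) => -[<-]; rewrite -/A2 -/c in b_le *.
  by rewrite PE /= in tE size_T *; lia.
have -> : size P + s < thead A by lia.
by move=> [<-]; rewrite sigma_tail // -/A2 -/c; lia.
Qed.

Lemma tdual_tempty n (A : n.+1.-tuple nat) :
  nondec_pos A -> tdual A (tempty n) = tci A.
Proof.
by case: n A => [|n] A /nondec_pos_thead A_gt0 /=; rewrite ?A_gt0 ?subn0.
Qed.

(** * Lex-closed monomials *)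

Section Lex.
Variables (k : fieldType) (n : nat).
Local Notation R := {mpoly k[n.+1]}.
Implicit Types (I : R -> Prop) (g h m w M : 'X_{1..n.+1}).

Lemma lem_mdeg_eq h g : (h <= g)%MM -> mdeg h = mdeg g -> h = g.
Proof.
move=> le_hg; rewrite -{1}(submK le_hg) mdegD => /esym/eqP.
rewrite -{2}[mdeg h]add0n eqn_add2r mdeg_eq0 => /eqP d0.
by rewrite -(submK le_hg) d0 add0m.
Qed.

(** Given m' lex-larger than g x_j, dividing m' by the last variable that occurs
    in it loses as little as possible: the quotient is lex-larger than g or
    equal to g, hence lies in I. *)
Lemma lex_closed_mul_var I g (j : 'I_n.+1) :
  (forall m i, I 'X_[m] -> I 'X_[m + U_(i)]) ->
  I 'X_[g] -> lex_closed_at I g -> lex_closed_at I (g + U_(j))%MM.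
Proof.
move=> I_up Ig g_lex m' deg_m' [i [eq_lt gt_i]].
have m'i_gt0 : 0 < m' i by apply: leq_ltn_trans gt_i.
have [l m'l_gt0 l_max] := @arg_maxnP _ i (fun q => 0 < m' q) val m'i_gt0.
have le_il : i <= l := l_max i m'i_gt0.
have le_lm' : (U_(l) <= m')%MM.
  by apply/mnm_lepP=> q; rewrite mnm1E; case: eqP => // <-.
(* From here on the goal is that h = m' / x_l lies in I. *)
pose h := (m' - U_(l))%MM; rewrite -(submK le_lm') -/h.
apply: (I_up h).
have deg_h : mdeg h = mdeg g.
  by move: deg_m'; rewrite -(submK le_lm') -/h !mdegD !mdeg1 => /eqP;
    rewrite eqn_add2r => /eqP.
have hE q : h q = m' q - (l == q) by rewrite mnmBE mnm1E.
have mE q : (g + U_(j))%MM q = g q + (j == q) by rewrite mnmDE mnm1E.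
have h_lt (q : 'I_n.+1) : q < i -> h q = g q + (j == q).
  move=> lt_qi; rewrite hE -mE -(eq_lt q lt_qi).
  by case: eqP => [lq|_]; [move: lt_qi; rewrite -lq ltnNge le_il|rewrite subn0].
have [lt_ji | le_ij] := ltnP j i.
  apply: g_lex => //; exists j; split; last first.
    by rewrite (h_lt j lt_ji) eqxx addn1.
  move=> q lt_qj; rewrite (h_lt q (ltn_trans lt_qj lt_ji)).
  by case: eqP lt_qj => [->|_]; rewrite ?ltnn ?addn0.
have h_eq (q : 'I_n.+1) : q < i -> h q = g q.
  move=> lt_qi; rewrite (h_lt q lt_qi).
  by case: eqP lt_qi => [<-|_]; rewrite ?addn0 // ltnNge le_ij.
have [gt_hi | le_hi] := ltnP (g i) (h i).
  by apply: g_lex => //; exists i.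
(* Now l = i and h agrees with g up to i and vanishes beyond. *)
suff -> : h = g by [].
apply: lem_mdeg_eq => //; apply/mnm_lepP => q.
have li : l = i.
  by apply/eqP; move: le_hi gt_i; rewrite hE mE; case: eqP => //; lia.
have [lt_qi | lt_iq | /val_inj -> //] := ltngtP q i; first by rewrite h_eq.
rewrite hE; suff -> : m' q = 0 by [].
apply/eqP; rewrite -leqn0 leqNgt; apply/negP => /l_max /=.
by rewrite li leqNgt lt_iq.
Qed.

Lemma lex_closed_mul I g w :
  (forall m i, I 'X_[m] -> I 'X_[m + U_(i)]) ->
  I 'X_[g] -> lex_closed_at I g -> I 'X_[g + w] /\ lex_closed_at I (g + w)%MM.
Proof.
move=> I_up Ig g_lex.
have [d] := ubnP (mdeg w); elim: d w => // d IHd w.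
have [-> _ | w_neq0 deg_w] := eqVneq w 0%MM; first by rewrite addm0.
have [j wj] : exists j, w j != 0.
  apply/existsP; apply: contraNT w_neq0; rewrite negb_exists.
  by move=> /forallP w0; apply/eqP/mnmP => q; rewrite mnm0E; apply/eqP/negbNE.
have le_jw : (U_(j) <= w)%MM by rewrite lep1mP.
have [|Iw lex_w] := IHd (w - U_(j))%MM.
  by move: deg_w; rewrite -{1}(submK le_jw) mdegD mdeg1 addn1 ltnS.
rewrite -(submK le_jw) addmA; split; first exact: I_up.
exact: lex_closed_mul_var.
Qed.

Lemma lex_gt_sub M m m' : (m <= M)%MM -> (m' <= M)%MM ->
  lex_gt m' m -> lex_gt (M - m)%MM (M - m')%MM.
Proof.
move=> /mnm_lepP le_m /mnm_lepP le_m' [i [eq_lt gt_i]]; exists i; split.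
  by move=> j /eq_lt eq_j; rewrite !mnmBE eq_j.
by rewrite !mnmBE ltn_sub2l // (leq_trans gt_i).
Qed.

End Lex.

(** * Monomial ideals *)

Section MonomialIdeals.
Variables (k : fieldType) (n : nat).
Local Notation R := {mpoly k[n.+1]}.
Implicit Types (I J : R -> Prop) (f : R) (g h m w M : 'X_{1..n.+1}).
Implicit Types (gs : seq 'X_{1..n.+1}) (A B : n.+1.-tuple nat).

Definition divisible gs m := has (fun g => (g <= m)%MM) gs.

Lemma divisible_le gs m m' : (m <= m')%MM -> divisible gs m -> divisible gs m'.
Proof.
move=> le_m /hasP[g gs_g le_g]; apply/hasP; exists g => //.
exact: lepm_trans le_m.
Qed.

Lemma mem_divisible gs g : g \in gs -> divisible gs g.
Proof. by move=> gs_g; apply/hasP; exists g => //; apply: lepm_refl. Qed.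

(** This reduces all ideal membership in the sequel to the combinatorics of
    divisibility between exponent vectors. *)
Lemma monomial_spanP gs f :
  monomial_span k gs f <-> {in msupp f, forall m, divisible gs m}.
Proof.
split=> [[c ->] m /msupp_sum_le/flattenP[s /mapP[i _ ->]] | f_gs].
  rewrite (perm_mem (msuppMX _ _)) => /mapP[w _ ->].
  apply: divisible_le (lem_addr _ _) _; exact/mem_divisible/mem_nth.
have term_in m : divisible gs m -> monomial_span k gs (f@_m *: 'X_[m])%R.
  move=> /hasP[g gs_g le_gm].
  have i_lt : index g gs < size gs by rewrite index_mem.
  exists (fun i => if i == Ordinal i_lt then (f@_m *: 'X_[m - g])%R else 0%R).
  rewrite (bigD1 (Ordinal i_lt)) //= eqxx nth_index // -scalerAl -mpolyXD.
  rewrite submK // big1 ?addr0 // => i /negPf ->; exact: mul0r.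
rewrite (mpolyE f) big_seq.
apply: (big_ind (monomial_span k gs)) => [|p q [c ->] [d ->]|m].
- by exists (fun=> 0%R); rewrite big1 // => i _; rewrite mul0r.
- exists (fun i => c i + d i)%R; rewrite -big_split /=.
  by apply: eq_bigr => i _; rewrite mulrDl.
- by move=> f_m; apply/term_in/f_gs.
Qed.

Lemma monomial_spanX gs m : monomial_span k gs 'X_[m] <-> divisible gs m.
Proof.
rewrite monomial_spanP; split=> [|gs_m m']; last first.
  by rewrite msuppX inE => /eqP ->.
by apply; rewrite msuppX mem_head.
Qed.

Lemma eq_monomial_span gs gs' : divisible gs =1 divisible gs' ->
  same_ideal (monomial_span k gs) (monomial_span k gs').
Proof.
by move=> eq_gs f; rewrite !monomial_spanP; split=> f_gs m /f_gs; rewrite eq_gs.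
Qed.

(** The generators minimal for divisibility suffice: among those dividing [m],
    one of least degree is minimal. *)
Lemma minimal_gens gs : exists gs',
  [/\ uniq gs', {in gs' &, forall g h, (g <= h)%MM -> g = h}
    & divisible gs' =1 divisible gs].
Proof.
pose minimal g := all (fun h => (h <= g)%MM ==> (h == g)) gs.
exists [seq g <- undup gs | minimal g]; split.
- exact/filter_uniq/undup_uniq.
- move=> g h; rewrite !mem_filter !mem_undup.
  move=> /andP[_ gs_g] /andP[/allP min_h _].
  by move=> le_gh; apply/eqP; have := min_h g gs_g; rewrite le_gh.
move=> m; apply/idP/idP => [/hasP[g] | gs_m].
  rewrite mem_filter mem_undup => /andP[_ gs_g] le_gm.
  by apply/hasP; exists g.
pose deg_div d := has (fun g => (g <= m)%MM && (mdeg g == d)) gs.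
have ex_d : exists d, deg_div d.
  have /hasP[g gs_g le_gm] := gs_m.
  by exists (mdeg g); apply/hasP; exists g; rewrite ?le_gm /=.
have [d /hasP[g gs_g /andP[le_gm /eqP deg_g]] min_d] := ex_minnP ex_d.
apply/hasP; exists g => //; rewrite mem_filter mem_undup gs_g andbT.
apply/allP => h gs_h; apply/implyP => le_hg; apply/eqP/lem_mdeg_eq => //.
apply/eqP; rewrite eqn_leq; apply/andP; split.
  by rewrite -(submK le_hg) mdegD leq_addl.
rewrite deg_g min_d //; apply/hasP; exists h => //.
by rewrite (lepm_trans le_hg) //=.
Qed.

Lemma antichain_minimally_generated I gs :
  same_ideal I (monomial_span k gs) -> uniq gs ->
  {in gs &, forall g h, (g <= h)%MM -> g = h} -> minimally_generated I gs.
Proof.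
move=> I_gs gs_uniq gs_anti; split=> // gs' sub_gs I_gs'.
have gs_sub : {subset gs <= gs'}.
  move=> g gs_g; have : I 'X_[g] by apply/I_gs/monomial_spanX/mem_divisible.
  move=> /I_gs'/monomial_spanX/hasP[h gs'_h le_hg].
  by rewrite -(gs_anti h g) // (mem_subseq sub_gs).
apply/eqP; rewrite -(size_subseq_leqif sub_gs) eqn_leq size_subseq //.
exact: uniq_leq_size.
Qed.

Lemma mem_pure_power A i : pure_power A i \in pure_powers A.
Proof. by rewrite map_f // mem_enum. Qed.

Lemma pure_powerE A i m : (pure_power A i <= m)%MM = (tnth A i <= m i).
Proof.
apply/mnm_lepP/idP => [/(_ i) | le_i j].
  by rewrite mulmnE mnm1E eqxx mul1n.
by rewrite mulmnE mnm1E; case: eqP => [<-|_]; rewrite ?mul1n.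
Qed.

Definition top_monomial A : 'X_{1..n.+1} := [multinom (tnth A i).-1 | i < n.+1].

Lemma divisible_pure_powers A m : all (leq 1) A ->
  divisible (pure_powers A) m = ~~ (m <= top_monomial A)%MM.
Proof.
move=> A_ge1; rewrite negb_forall.
apply/hasP/existsP => [[g /mapP[i _ ->]]|[i]].
  rewrite pure_powerE => le_i; exists i; rewrite mnmE.
  by have := all_tnthP A_ge1 i; lia.
rewrite mnmE -ltnNge => lt_i.
exists (pure_power A i); first exact: mem_pure_power.
by rewrite pure_powerE; lia.
Qed.

(** Beyond the pure powers, only the finitely many divisors of the top monomial
    can be minimal in [p]; it is applied to the monomials of a residual, whose
    generators have no closed form. *)
Lemma finite_gens A (p : pred 'X_{1..n.+1}) : all (leq 1) A ->
  (forall m m', (m <= m')%MM -> p m -> p m') ->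
  (forall i, p (pure_power A i)) -> exists gs, divisible gs =1 p.
Proof.
move=> A_ge1 p_up pA; pose M := top_monomial A.
pose small := map val (enum {: 'X_{1..n.+1 < (mdeg M).+1}}).
exists (pure_powers A ++ [seq m <- small | p m]).
move=> m; rewrite /divisible has_cat; apply/orP/idP => [[]|pm].
- by case/hasP => g /mapP[i _ ->] /p_up; apply.
- by case/hasP => g; rewrite mem_filter => /andP[pg _] /p_up; apply.
case: (boolP (m <= M)%MM) => [le_mM | ]; last first.
  by rewrite -divisible_pure_powers //; left.
right; apply/hasP; exists m; last exact: lepm_refl.
have m_lt : mdeg m < (mdeg M).+1.
  by rewrite ltnS -(submK le_mM) mdegD leq_addl.
rewrite mem_filter pm; apply/mapP.
by exists (BMultinom m_lt); rewrite ?mem_enum.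
Qed.

(** * Lex plus powers ideals and their residuals *)

Lemma lem0m m : (0 <= m)%MM.
Proof. by apply/mnm_lepP => i; rewrite mnm0E. Qed.

Lemma pure_powerF A i j : pure_power A i j = (i == j) * tnth A i.
Proof. by rewrite mulmnE mnm1E. Qed.

Lemma divisible_pure_power A B j : all (leq 1) A ->
  divisible (pure_powers A) (pure_power B j) = (tnth A j <= tnth B j).
Proof.
move=> A_ge1; apply/hasP/idP => [[g /mapP[i _ ->]]|le_j].
  rewrite pure_powerE pure_powerF; case: eqP => [->|_]; first by rewrite mul1n.
  by have := all_tnthP A_ge1 i; lia.
exists (pure_power A j); first exact: mem_pure_power.
by rewrite pure_powerE pure_powerF eqxx mul1n.
Qed.

Lemma pure_power_inj A : all (leq 1) A -> injective (pure_power A).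
Proof.
move=> A_ge1 i j /mnmP/(_ i); rewrite !pure_powerF eqxx.
by case: eqP => // _; have := all_tnthP A_ge1 i; lia.
Qed.

(** In other words, the image of I in R / J is spanned by a lex segment in each
    degree. This form does not mention minimal generators. *)
Definition lex_mod_powers A I gs :=
  [/\ same_ideal I (monomial_span k gs),
      forall i, divisible gs (pure_power A i),
      ~~ divisible gs 0%MM &
      forall m, divisible gs m -> ~~ divisible (pure_powers A) m ->
        lex_closed_at I m].

(** A monomial outside J is a multiple of a generator other than the powers
    prescribed by [A], and such generators are lex-closed. The ideal is proper
    because a constant generator would make the pure powers redundant. *)
Lemma lpp_le_ideal_lex A I :
  lpp_le_ideal A I -> exists gs, lex_mod_powers A I gs.
Proof.
move=> [B [[_ B_ge1 [ms [[I_gs gs_min] ms_lex]]] I_A B_lex]].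
exists (pure_powers B ++ ms); split=> //.
- by move=> i; apply/monomial_spanX/I_gs; rewrite -mpolyXn; apply: I_A.
- apply/negP => /hasP[g gs_g le_g0].
  have {le_g0} g0 : g = 0%MM.
    by apply/mnmP=> i; have := mnm_lepP le_g0 i; rewrite mnm0E; lia.
  have I_all f : I f.
    apply/I_gs/monomial_spanP => m _; apply/hasP.
    by exists g => //; rewrite g0 lem0m.
  have gs_g1 : [:: g] = pure_powers B ++ ms.
    apply: gs_min; first by rewrite sub1seq.
    move=> f; split=> // _; apply/monomial_spanP => m _.
    by rewrite g0 /divisible /= lem0m.
  have : pure_power B ord0 \in [:: g] by rewrite gs_g1 mem_cat mem_pure_power.
  rewrite inE g0 => /eqP/mnmP/(_ ord0); rewrite pure_powerF mnm0E eqxx.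
  by have := all_tnthP B_ge1 ord0; lia.
move=> m /hasP[g gs_g le_gm] mNA.
have I_up m' i : I 'X_[m'] -> I 'X_[m' + U_(i)].
  rewrite !I_gs !monomial_spanX; exact/divisible_le/lem_addr.
have Ig : I 'X_[g] by apply/I_gs/monomial_spanX/mem_divisible.
have g_lex : lex_closed_at I g.
  move: gs_g; rewrite mem_cat => /orP[/mapP[i _ g_i]|]; last exact: ms_lex.
  rewrite g_i; apply: B_lex; rewrite ltnNge; apply: contra mNA => le_AB.
  apply/hasP; exists (pure_power A i); first exact: mem_pure_power.
  apply: lepm_trans le_gm.
  by rewrite g_i pure_powerE pure_powerF eqxx mul1n.
by rewrite -(submK le_gm) addmC; apply: (lex_closed_mul _ I_up Ig g_lex).2.
Qed.

(** The generators are the minimal ones, with [B] the exponents of the pure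
    powers among them. *)
Lemma lex_lpp_le_ideal A I gs : all (leq 1) A -> sorted leq A ->
  lex_mod_powers A I gs -> lpp_le_ideal A I.
Proof.
move=> A_ge1 A_sorted [I_gs A_gs gsN0 gs_lex].
have IX m : I 'X_[m] <-> divisible gs m by rewrite I_gs monomial_spanX.
have [gs' [gs'_uniq gs'_anti gs'E]] := minimal_gens gs.
have A_mono (i j : 'I_n.+1) : i <= j -> tnth A i <= tnth A j.
  move=> le_ij; rewrite !(tnth_nth 0).
  by apply: (sorted_leq_nth leq_trans leqnn) => //; rewrite inE size_tuple.
have ex_b i : exists b, divisible gs (U_(i) *+ b)%MM.
  by exists (tnth A i); apply: A_gs.
pose B := [tuple ex_minn (ex_b i) | i < n.+1].
have gs_B i : divisible gs (pure_power B i).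
  by rewrite /pure_power tnth_mktuple; case: ex_minnP.
have B_min i b : divisible gs (U_(i) *+ b)%MM -> tnth B i <= b.
  by rewrite tnth_mktuple; case: ex_minnP => c _; apply.
have B_ge1 : all (leq 1) B.
  apply/all_tnthP => i; rewrite lt0n; apply: contraNneq gsN0 => Bi0.
  by have := gs_B i; rewrite /pure_power Bi0.
have le_BA i : tnth B i <= tnth A i by apply: B_min; apply: A_gs.
have B_lex i : tnth B i < tnth A i -> lex_closed_at I (pure_power B i).
  by move=> lt_i; apply: gs_lex => //; rewrite divisible_pure_power // -ltnNge.
(* If b_j < b_i then b_j < a_j, so x_j^b_j is lex-closed and x_i^b_j lies in I,
   against the minimality of b_i. *)
have B_mono (i j : 'I_n.+1) : i < j -> tnth B i <= tnth B j.
  move=> lt_ij; rewrite leqNgt; apply/negP => lt_ji.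
  have : I 'X_[U_(i) *+ tnth B j].
    apply: (B_lex j).
    - exact: leq_trans lt_ji (leq_trans (le_BA i) (A_mono i j (ltnW lt_ij))).
    - by rewrite !mdegMn !mdeg1.
    exists i; split=> [q lt_qi|].
      rewrite pure_powerF mulmnE mnm1E.
      by rewrite !(gtn_eqF, =^~ val_eqE) //= ; lia.
    rewrite pure_powerF mulmnE mnm1E eqxx [j == i]gtn_eqF // mul1n mul0n.
    exact: (all_tnthP B_ge1 j).
  by move/IX/B_min; rewrite leqNgt lt_ji.
have gs'_B i : pure_power B i \in gs'.
  have := gs_B i; rewrite -gs'E => /hasP[g gs'_g le_g].
  suff -> : pure_power B i = g by [].
  have g_off j : i != j -> g j = 0.
    move/negPf=> ne_ij; have := mnm_lepP le_g j.
    by rewrite pure_powerF ne_ij; lia.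
  have g_i : g = (U_(i) *+ g i)%MM.
    apply/mnmP=> j; rewrite mulmnE mnm1E.
    by case: eqVneq => [->|/g_off->]; rewrite ?mul1n.
  have := mnm_lepP le_g i; rewrite pure_powerF eqxx mul1n => le_gi.
  rewrite [RHS]g_i /pure_power; congr (_ *+ _)%MM; apply/eqP.
  rewrite eqn_leq le_gi andbT; apply: B_min; rewrite -g_i -gs'E.
  exact: mem_divisible.
pose ms := [seq g <- gs' | g \notin pure_powers B].
have gs'_mem : pure_powers B ++ ms =i gs'.
  move=> g; rewrite mem_cat mem_filter.
  case: (boolP (g \in pure_powers B)) => //=.
  by case/mapP => i _ ->; rewrite gs'_B.
exists B; split=> //; first split=> //.
- apply/(sortedP 0) => i; rewrite size_tuple => lt_i.
  have := B_mono (Ordinal (ltnW lt_i)) (Ordinal lt_i) (ltnSn i).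
  by rewrite !(tnth_nth 0).
- exists ms; split; first apply: antichain_minimally_generated.
  + move=> f; rewrite I_gs; apply: eq_monomial_span => m.
    by rewrite -gs'E; apply: eq_has_r.
  + rewrite cat_uniq map_inj_uniq ?enum_uniq; last exact: pure_power_inj.
    rewrite filter_uniq // andbT; apply/hasPn => g.
    by rewrite mem_filter => /andP[].
  + by move=> g h; rewrite !gs'_mem; apply: gs'_anti.
  move=> g; rewrite mem_filter => /andP[gNB gs'_g].
  apply: gs_lex; first by rewrite -gs'E; apply: mem_divisible.
  apply: contra gNB => /hasP[_ /mapP[i _ ->] le_g].
  suff <- : pure_power B i = g by apply: mem_pure_power.
  apply: gs'_anti => //; apply: lepm_trans le_g.
  by rewrite pure_powerE pure_powerF eqxx mul1n.
by move=> i; rewrite mpolyXn; apply/IX/A_gs.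
Qed.

Lemma colon_monomialP A I gs f : same_ideal I (monomial_span k gs) ->
  colon (monomial_span k (pure_powers A)) I f <->
  {in msupp f, forall m, all (fun g => divisible (pure_powers A) (m + g)) gs}.
Proof.
move=> I_gs; split=> [f_colon m f_m | f_gs h].
  apply/allP => g gs_g.
  have /f_colon/monomial_spanP : I 'X_[g].
    exact/I_gs/monomial_spanX/mem_divisible.
  by apply; rewrite (perm_mem (msuppMX _ _)) addmC map_f.
rewrite I_gs => /monomial_spanP h_gs; apply/monomial_spanP => m.
move=> /msuppM_le/allpairsP[[m1 m2] /= [f_m1 /h_gs/hasP[g gs_g le_g] ->]].
apply: divisible_le (allP (f_gs m1 f_m1) g gs_g).
by rewrite -(submK le_g) [(_ - _ + _)%MM]addmC addmA; apply: lem_addr.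
Qed.

(** The product m g avoids J exactly when it divides M, that is, when g divides
    M / m. *)
Lemma colon_top A gs m : all (leq 1) A -> (m <= top_monomial A)%MM ->
  all (fun g => divisible (pure_powers A) (m + g)) gs
    = ~~ divisible gs (top_monomial A - m)%MM.
Proof.
move=> A_ge1 le_mM; rewrite -all_predC; apply: eq_all => g /=.
rewrite divisible_pure_powers //; congr negb; apply/mnm_lepP/mnm_lepP => le_M i;
by have := le_M i; have := mnm_lepP le_mM i; rewrite mnmDE mnmBE; lia.
Qed.

Lemma colon_lpp A I (J := monomial_span k (pure_powers A)) :
  all (leq 1) A -> sorted leq A -> lpp_le_ideal A I ->
  lpp_le_ideal A (colon J I) \/
  (same_ideal (colon J I) unit_ideal /\ same_ideal I J).
Proof.
move=> A_ge1 A_sorted /lpp_le_ideal_lex[gs [I_gs A_gs gsN0 gs_lex]].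
pose p m := all (fun g => divisible (pure_powers A) (m + g)%MM) gs.
have p_up m m' : (m <= m')%MM -> p m -> p m'.
  move=> le_m /allP pm; apply/allP => g /pm; apply: divisible_le.
  by apply/mnm_lepP => i; rewrite !mnmDE leq_add2r (mnm_lepP le_m).
have pA m : divisible (pure_powers A) m -> p m.
  by move=> Am; apply/allP => g _; apply: divisible_le Am; apply: lem_addr.
have colonE f : colon J I f <-> {in msupp f, forall m, p m}.
  exact: colon_monomialP.
(* The residual is the unit ideal exactly when I is contained in J. *)
have [p0 | pN0] := boolP (p 0%MM).
  right; split=> f.
    by split=> // _; apply/colonE => m _; apply: p_up p0; apply: lem0m.
  split; first rewrite I_gs.
    move=> /monomial_spanP f_gs; apply/monomial_spanP => m.
    move=> /f_gs/hasP[g gs_g le_g].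
    by apply: divisible_le le_g _; rewrite -[g]add0m (allP p0).
  move=> /monomial_spanP f_A; apply/I_gs/monomial_spanP => m /f_A.
  by case/hasP => _ /mapP[i _ ->] le_m; apply: divisible_le (A_gs i).
left; have [i|gs' gs'E] := @finite_gens A p A_ge1 p_up.
  exact/pA/mem_divisible/mem_pure_power.
apply: (@lex_lpp_le_ideal A _ gs') => //; split=> [f|i||m].
- by rewrite colonE monomial_spanP; split=> f_p m /f_p; rewrite gs'E.
- by rewrite gs'E; apply/pA/mem_divisible/mem_pure_power.
- by rewrite gs'E.
rewrite gs'E divisible_pure_powers // negbK => pm le_mM m' deg_m' gt_m'.
apply/colonE => m''; rewrite msuppX inE => /eqP -> {m''}.
have [le_m'M | m'N] := boolP (m' <= top_monomial A)%MM; last first.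
  by apply: pA; rewrite divisible_pure_powers.
move: pm; rewrite /p !colon_top //; apply: contra => gs_m'.
apply/monomial_spanX/I_gs; apply: (gs_lex _ gs_m').
- by rewrite divisible_pure_powers // negbK lem_subr.
- apply/eqP; rewrite -(eqn_add2r (mdeg m)) -mdegD submK // -deg_m'.
  by rewrite -mdegD submK.
exact: lex_gt_sub.
Qed.

(** Here J : R = J, and the lex condition on J is vacuous. *)
Lemma colon_unit A I (J := monomial_span k (pure_powers A)) :
  all (leq 1) A -> sorted leq A -> same_ideal I unit_ideal ->
  lpp_le_ideal A (colon J I).
Proof.
move=> A_ge1 A_sorted I_unit.
apply: (lex_lpp_le_ideal A_ge1 A_sorted (gs := pure_powers A)).
split=> [f|i||m ->//]; last by rewrite divisible_pure_powers // negbK lem0m.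
  have I_gs : same_ideal I (monomial_span k [:: 0%MM]).
    move=> g; rewrite I_unit monomial_spanP; split=> // _ m _.
    by rewrite /divisible /= lem0m.
  rewrite (colon_monomialP _ _ I_gs) monomial_spanP.
  by split=> f_A m /f_A /=; rewrite andbT addm0.
exact/mem_divisible/mem_pure_power.
Qed.

End MonomialIdeals.

Theorem corollary2 (k : fieldType) (n : nat) (A : n.+1.-tuple nat)
    (A_ge1 : all (leq 1) A) (A_sorted : sorted leq A) :
  (forall T : tvec n,
     lpp_le_vector A T \/ T = tempty n ->
     lpp_le_vector A (tdual A T) \/ (tdual A T = tempty n /\ T = tci A))
  /\
  (forall I : {mpoly k[n.+1]} -> Prop,
     let J := monomial_span k (pure_powers A) in
     lpp_le_ideal A I \/ same_ideal I unit_ideal ->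
     lpp_le_ideal A (colon J I)
     \/ (same_ideal (colon J I) unit_ideal /\ same_ideal I J)).
Proof.
have A_ok : nondec_pos A by apply/andP.
split=> [T [T_lpp|->]|I J [I_lpp|I_unit]].
- have [->|TNci] := eqVneq T (tci A); first by right; rewrite tdual_tci.
  by left; have [] := tdual_exchange A_ok T_lpp TNci.
- by left; rewrite tdual_tempty //; apply: lpp_tci.
- exact: colon_lpp.
by left; apply: colon_unit.
Qed.
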